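(* Let $\mathcal N=\{1,\dots,N\}$ with $N\ge 2$, and let $P_f$ be a polymatroid with rank function $f:2^{\mathcal N}\to\mathbb R$ such that $f(\mathcal N)=1$ and the minimum distance $\triangle f$ is strictly positive. Let $M$ be an integer with $M\ge \frac{2}{\triangle f}$ and define $\tilde f(S)=\lfloor f(S)M\rfloor$ for every $S\subseteq\mathcal N$. Then $P_{\tilde f}$ is an integral polymatroid; that is, $\tilde f$ is integer-valued, normalized, monotone and submodular.
   Context: A set function $f:2^{\mathcal N}\to\mathbb R$ is normalized if $f(\emptyset)=0$, monotone if $f(S)\le f(T)$ whenever $S\subseteq T$, and submodular if $f(S)+f(T)\ge f(S\cap T)+f(S\cup T)$ for all $S,T\subseteq \mathcal N$. If $f$ is normalized, monotone and submodular, then $P_f=\{\mathbf x\in\mathbb R_+^N:\sum_{n\in S}x_n\le f(S)\ \forall S\subseteq\mathcal N\}$ is called the polymatroid with rank function $f$. The minimum distance of $f$ is $\triangle f=\min_{S\subseteq\mathcal N}\ \min_{i,j\in\mathcal N\setminus S,\ i\neq j}|f(S\cup\{i\})+f(S\cup\{j\})-f(S)-f(S\cup\{i,j\})|$. For an integer-valued, normalized, monotone, submodular $\tilde f$, the integral polymatroid with rank function $\tilde f$ is $P_{\tilde f}=\{\mathbf y\in\mathbb N^N:\sum_{n\in S}y_n\le\tilde f(S)\ \forall S\subseteq\mathcal N\}$ (where $\mathbb N$ includes $0$). *)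

(* Defs.v *)
From mathcomp Require Import all_boot all_order all_algebra.
From mathcomp Require Import classical_sets reals constructive_ereal.

Set Implicit Arguments.
Unset Strict Implicit.
Unset Printing Implicit Defensive.

Import Order.TTheory GRing.Theory Num.Theory.

Local Open Scope ring_scope.

(* The ground set {1, ..., N} is 'I_N, and a set function is a real-valued
   function on {set 'I_N}. *)

Definition sf_normalized (R : realType) (N : nat) (f : {set 'I_N} -> R) : Prop :=
  f finset.set0 = 0.

Definition sf_monotone (R : realType) (N : nat) (f : {set 'I_N} -> R) : Prop :=
  forall S T : {set 'I_N}, S \subset T -> f S <= f T.

Definition sf_submodular (R : realType) (N : nat) (f : {set 'I_N} -> R) : Prop :=
  forall S T : {set 'I_N}, f S + f T >= f (S :&: T) + f (S :|: T).

Definition sf_integer_valued (R : realType) (N : nat) (f : {set 'I_N} -> R) : Prop :=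
  forall S : {set 'I_N}, f S \is a Num.int.

Definition polymatroid_region (R : realType) (N : nat) (f : {set 'I_N} -> R) :
    set 'rV[R]_N :=
  [set x : 'rV[R]_N | (forall n, 0 <= x 0 n) /\
     (forall S : {set 'I_N}, \sum_(n in S) x 0 n <= f S)]%classic.

Definition is_polymatroid (R : realType) (N : nat) (P : set 'rV[R]_N)
    (f : {set 'I_N} -> R) : Prop :=
  [/\ sf_normalized f, sf_monotone f, sf_submodular f
    & P = polymatroid_region f].

Definition integral_polymatroid_region (R : realType) (N : nat)
    (g : {set 'I_N} -> R) : set 'rV[nat]_N :=
  [set y : 'rV[nat]_N |
     forall S : {set 'I_N}, \sum_(n in S) (y ord0 n)%:R <= g S]%classic.

Definition is_integral_polymatroid (R : realType) (N : nat) (P : set 'rV[nat]_N)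
    (g : {set 'I_N} -> R) : Prop :=
  [/\ sf_integer_valued g, sf_normalized g, sf_monotone g, sf_submodular g
    & P = integral_polymatroid_region g].

(* The minimum is taken in the extended reals, so that the sets S whose
   complement has fewer than two elements contribute +oo, i.e. nothing.  For
   N >= 2 the overall minimum is finite and [fine] returns it; for N < 2 there
   is no admissible (S, i, j) and the value is the junk value 0. *)
Definition min_distance (R : realType) (N : nat) (f : {set 'I_N} -> R) : R :=
  fine (\big[Order.min/+oo%E]_(S : {set 'I_N})
    \big[Order.min/+oo%E]_(ij : 'I_N * 'I_N |
        [&& ij.1 \in ~: S, ij.2 \in ~: S & ij.1 != ij.2])
      (`| f (S :|: [set ij.1]) + f (S :|: [set ij.2])
          - f S - f (S :|: [set ij.1; ij.2]) |)%:E).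

Definition floor_scaling (R : realType) (N : nat) (f : {set 'I_N} -> R) (M : int) :
    {set 'I_N} -> R :=
  fun S => (Num.floor (f S * M%:~R))%:~R.

(* Main.v *)
Require Import Defs.
From mathcomp Require Import all_boot all_order all_algebra.
From mathcomp Require Import classical_sets reals constructive_ereal.
From mathcomp Require Import lra.

Import Order.TTheory GRing.Theory Num.Theory.

Local Open Scope ring_scope.

(** Scaling by [M] turns every local submodularity gap, which is at least the
minimum distance, into a gap of at least [2], and taking floors in
[a + b - c - d] decreases it by less than [2]. Hence the floored function
satisfies the local exchange inequalities, and these already imply
submodularity. *)

(** Induction on the size of [B :\: A]: elements of [B] outside [A] are removed one at a time, and
    each local inequality compares the marginal gains of [i] before and after one removal. *)
Lemma setU1_submodular_marginal (R : realDomainType) (T : finType)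
    (g : {set T} -> R) :
  (forall (S : {set T}) i j, i \notin S -> j \notin S -> i != j ->
     g S + g (S :|: [set i; j]) <= g (S :|: [set i]) + g (S :|: [set j])) ->
  forall (A B : {set T}) i, A \subset B -> i \notin B ->
    g A + g (i |: B) <= g (i |: A) + g B.
Proof.
move=> gloc A B i sAB; move: {2}#|B :\: A| (leqnn #|B :\: A|) => n.
elim: n B sAB => [|n IHn] B sAB cardBA iB.
  have -> : B = A.
    apply/eqP; rewrite finset.eqEsubset sAB andbT -finset.setD_eq0 -cards_eq0.
    by rewrite -leqn0.
  by rewrite addrC.
have [BA0|[j]] := finset.set_0Vmem (B :\: A).
  by apply: IHn => //; rewrite BA0 cards0.
rewrite inE => /andP[jA jB].
have iNj : i != j by apply: contraNneq iB => ->.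
have sABj : A \subset B :\ j by rewrite finset.subsetD1 sAB.
have := IHn _ sABj; rewrite !inE iNj (negPf iB) => /(_ _ isT) IH.
have {}IH : g A + g (i |: B :\ j) <= g (i |: A) + g (B :\ j).
  apply: IH; rewrite -ltnS; apply: leq_trans cardBA; apply: proper_card.
  rewrite finset.setDDl finset.setUC -finset.setDDl finset.properD1 //.
  by rewrite inE jA.
(* At [B :\ j] the local inequality says that the gain of [i] does not grow when [j] is put back.
   Adding [IH] cancels the two terms at [B :\ j] and [i |: B :\ j]. *)
have := gloc (B :\ j) i j; rewrite !inE eqxx (negPf iB) andbF iNj.
move=> /(_ isT isT isT).
have -> : B :\ j :|: [set i; j] = i |: B.
  by rewrite finset.setUC -finset.setUA finset.setD1K.
rewrite (finset.setUC _ [set i]) (finset.setUC _ [set j]) finset.setD1K //.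
by lra.
Qed.

(** Induction on the size of [T :\: S], building [T] up from a subset of [S] and controlling each
    added element by its diminishing marginal gain. *)
Lemma local_submodular (R : realType) (N : nat) (g : {set 'I_N} -> R) :
  (forall (S : {set 'I_N}) i j, i \notin S -> j \notin S -> i != j ->
     g S + g (S :|: [set i; j]) <= g (S :|: [set i]) + g (S :|: [set j])) ->
  sf_submodular g.
Proof.
move=> gloc S T; move: {2}#|T :\: S| (leqnn #|T :\: S|) => n.
elim: n T => [|n IHn] T cardTS.
  have sTS : T \subset S by rewrite -finset.setD_eq0 -cards_eq0 -leqn0.
  by rewrite (finset.setIidPr sTS) (finset.setUidPl sTS) addrC.
have [TS0|[i]] := finset.set_0Vmem (T :\: S).
  by apply: IHn; rewrite TS0 cards0.
rewrite inE => /andP[iS iT].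
have {}IHn : g (S :&: (T :\ i)) + g (S :|: (T :\ i)) <= g S + g (T :\ i).
  apply: IHn; rewrite -ltnS; apply: leq_trans cardTS; apply: proper_card.
  rewrite finset.setDDl finset.setUC -finset.setDDl finset.properD1 //.
  by rewrite inE iS.
(* Adding [i] gains at least as much over [T :\ i] as over the larger [S :|: T :\ i]. In the sum
   with [IHn] the values at these two sets cancel. *)
have := @setU1_submodular_marginal _ _ _ gloc (T :\ i) (S :|: T :\ i) i.
rewrite finset.subsetUr !inE eqxx (negPf iS) => /(_ isT isT).
rewrite finset.setUCA finset.setD1K //.
have <- : S :&: (T :\ i) = S :&: T.
  apply/setP=> x; rewrite !inE; have [->|//] := eqVneq x i.
  by rewrite (negPf iS).
by lra.
Qed.

Lemma min_distance_le (R : realType) (N : nat) (f : {set 'I_N} -> R)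
    (S : {set 'I_N}) i j :
  0 < min_distance f -> i \notin S -> j \notin S -> i != j ->
  min_distance f <=
    `| f (S :|: [set i]) + f (S :|: [set j]) - f S - f (S :|: [set i; j]) |.
Proof.
rewrite /min_distance; set d := (\big[_/_]_S _)%O => d_gt0 iS jS ij.
suff: (d <= (`| f (S :|: [set i]) + f (S :|: [set j])
              - f S - f (S :|: [set i; j]) |)%:E)%E.
  (* [fine] sends both infinities to 0, so positivity forces [d] to be finite. *)
  by case: d d_gt0 => [r||] //=; rewrite ?ltxx.
rewrite /d (bigD1 S) //= ge_min; apply/orP; left.
by rewrite (bigD1 (i, j)) /= ?inE ?iS ?jS ?ij // ge_min lexx.
Qed.

(** Rounding down costs [a] and [b] less than 1 each and can only lower [c] and [d], so a gap of 2
    suffices. *)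
Lemma floor_exchange (R : archiRealDomainType) (a b c d : R) : c + d + 2 <= a + b ->
  (Num.floor c)%:~R + (Num.floor d)%:~R <=
    (Num.floor a)%:~R + (Num.floor b)%:~R :> R.
Proof.
move=> gap.
have := floorD1_gt a; have := floorD1_gt b.
have := floor_le c; have := floor_le d.
by rewrite !intrD; lra.
Qed.

Theorem theorem3p5 (R : realType) (N : nat) (f : {set 'I_N} -> R) (M : int)
  (hN : (2 <= N)%N)
  (hf : is_polymatroid (polymatroid_region f) f)
  (hf1 : f [set: 'I_N] = 1)
  (hdist : 0 < min_distance f)
  (hM : M%:~R >= 2 / min_distance f) :
  is_integral_polymatroid
    (integral_polymatroid_region (floor_scaling f M)) (floor_scaling f M).
Proof.
case: hf => f0 fmono fsub _.
have M_ge0 : 0 <= M%:~R :> R.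
  by apply: le_trans hM; rewrite divr_ge0 // ltW.
split=> //.
- by move=> S; rewrite /floor_scaling intr_int.
- by rewrite /sf_normalized /floor_scaling f0 mul0r floor0.
- move=> S T sST; rewrite /floor_scaling ler_int.
  by apply: le_floor; rewrite ler_wpM2r // fmono.
apply: local_submodular => S i j iS jS ij; apply: floor_exchange.
have := min_distance_le _ _ f S i j hdist iS jS ij.
(* Submodularity of [f] makes the local gap nonnegative, which removes the absolute value in the
   minimum distance. *)
have := fsub (S :|: [set i]) (S :|: [set j]).
have -> : (S :|: [set i]) :&: (S :|: [set j]) = S.
  rewrite -finset.setUIr; apply/finset.setUidPl/fintype.subsetP=> x.
  by rewrite !inE => /andP[/eqP-> /eqP eij]; rewrite eij eqxx in ij.
rewrite -finset.setUUr => loc; rewrite ger0_norm; last by lra.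
move=> gap.
have : 2 <= M%:~R * min_distance f by rewrite -ler_pdivrMr.
have := ler_wpM2l M_ge0 gap.
by lra.
Qed.
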